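(* Let $G$ be an infinite countable discrete amenable group admitting a tiling F\o lner sequence, and let $f:\mathcal{F}_G\to\mathbb{R}$ be a function. Assume that $f(Eg)=f(E)$ and $f(E\cup F)\le f(E)+f(F)$ whenever $g\in G$ and $E,F\in\mathcal{F}_G$ satisfy $E\cap F=\emptyset$. Then for any tiling F\o lner sequence $\{F_n:n\in\mathbb{N}\}$ of $G$, the sequence $\{\frac{f(F_n)}{|F_n|}:n\in\mathbb{N}\}$ converges and the limit is independent of the choice of the tiling F\o lner sequence $\{F_n:n\in\mathbb{N}\}$. Furthermore, $$\lim_{n\to\infty}\frac{f(F_n)}{|F_n|}=\inf_{F\in\mathcal{T}_G}\frac{f(F)}{|F|}\quad\Big(\text{and so }=\inf_{n\in\mathbb{N}}\frac{f(F_n)}{|F_n|}\Big).$$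
   Context: $\mathcal{F}_G$ is the set of all non-empty finite subsets of $G$. A F\o lner sequence is a sequence $\{F_n\}$ in $\mathcal{F}_G$ with $\lim_n|gF_n\Delta F_n|/|F_n|=0$ for each $g\in G$. A non-empty set $T\subseteq G$ tiles $G$ if there is $\emptyset\ne G_T\subseteq G$ such that $\{Tc:c\in G_T\}$ is a partition of $G$. $\mathcal{T}_G$ is the set of all non-empty finite subsets of $G$ that tile $G$. A tiling F\o lner sequence is a F\o lner sequence all of whose members belong to $\mathcal{T}_G$. Convergence is in $[-\infty,\infty)$, i.e. the value $-\infty$ is allowed for the limit and infimum. *)

(* Defs.v *)
From HB Require Import structures.
From mathcomp Require Import all_boot all_order all_algebra finmap.
From mathcomp Require Import all_classical all_reals all_analysis.

Set Implicit Arguments.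
Unset Strict Implicit.
Unset Printing Implicit Defensive.

Import Order.TTheory GRing.Theory Num.Theory.
Import numFieldNormedType.Exports.

Local Open Scope classical_set_scope.
Local Open Scope ring_scope.

Definition nonempty_fsets (G : groupType) : set {fset G} :=
  [set E | E != fset0].

Definition ltrans (G : groupType) (g : G) (E : {fset G}) : {fset G} :=
  [fset (g * x)%g | x in E]%fset.

Definition rtrans (G : groupType) (E : {fset G}) (g : G) : {fset G} :=
  [fset (x * g)%g | x in E]%fset.

Definition symdiff (K : choiceType) (A B : {fset K}) : {fset K} :=
  ((A `\` B) `|` (B `\` A))%fset.

Definition folner (R : realType) (G : groupType) (F : nat -> {fset G}) : Prop :=
  (forall n, nonempty_fsets (F n)) /\
  forall g : G,
    (#|` symdiff (ltrans g (F n)) (F n)|%:R / #|` F n|%:R : R)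
      @[n --> \oo] --> (0 : R).

(* Amenability of a countable discrete group. *)
Definition amenable (R : realType) (G : groupType) : Prop :=
  exists F : nat -> {fset G}, folner R F.

(* The translates [T c] form a partition as a set of subsets of [G]: distinct
   [c] in [C] may give the same translate. *)
Definition tiles (G : groupType) (T : set G) : Prop :=
  T !=set0 /\
  exists C : set G, C !=set0 /\
    partition [set [set (t * c)%g | t in T] | c in C] id [set: G].

Definition tile_fsets (G : groupType) : set {fset G} :=
  [set T | nonempty_fsets T /\ tiles [set` T]].

Definition tiling_folner (R : realType) (G : groupType)
    (F : nat -> {fset G}) : Prop :=
  folner R F /\ forall n, tile_fsets (F n).

(* Functions on non-empty finite sets are represented by total functions on
   [{fset G}]; the value at [fset0] is never used. *)
Definition avg (R : realType) (G : groupType) (f : {fset G} -> R)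
    (E : {fset G}) : R := f E / #|` E|%:R.

(* Main.v *)
Require Import Defs.
From HB Require Import structures.
From mathcomp Require Import all_boot all_order all_algebra finmap.
From mathcomp Require Import all_classical all_reals all_analysis.

Import Order.TTheory GRing.Theory Num.Theory.
Import numFieldNormedType.Exports.

Local Open Scope classical_set_scope.
Local Open Scope ring_scope.

(** Fix a tile [T].  Cutting a finite set [E] along the translates of [T] that
    tile the group, subadditivity and invariance bound [f E] by
    [avg f T * #|E|] plus a constant times the number of points of [E] whose
    translate of [T] sticks out of [E] ([subadditive_packing]).  The translate
    containing [x] lies in [T T^-1 x], so such a point is moved out of [E] by
    left multiplication by one of the finitely many elements of [T T^-1]; along
    a Folner sequence the proportion of these points tends to [0]
    ([folner_moved_cvg0]).  Hence [limsup avg f (F n) <= avg f T] for every tile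
    [T] and every Folner sequence [F] ([folner_avg_lt]).  When the [F n] are
    tiles themselves, [avg f (F n)] is also at least the infimum over all
    tiles, so it converges to this infimum, which is then its own infimum too. *)

(** Points of [E] that left multiplication by some element of [s] moves out
    of [E]. *)
Definition moved_out {G : groupType} (s : seq G) (E : {fset G}) : {fset G} :=
  [fset x in E | has (fun g => (g * x)%g \notin E) s]%fset.

(** Points of [E] whose block [tile x] is not contained in [E]; the function
    [tile] sends a point to the block of a partition that contains it. *)
Definition escaping {G : groupType} (tile : G -> {fset G}) (E : {fset G}) :
    {fset G} :=
  [fset x in E | ~~ (tile x `<=` E)%fset]%fset.

Lemma card_moved_out1 {G : groupType} (g : G) (E : {fset G}) :
  (#|` moved_out [:: g] E| <= #|` symdiff (ltrans g E) E|)%N.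
Proof.
rewrite -(card_imfset imfset_key (mem (moved_out [:: g] E)) (mulgI g)).
apply: fsubset_leq_card; apply/fsubsetP => y /imfsetP[x /= xM ->{y}].
move: xM; rewrite !inE /= orbF => /andP[xE gxE].
rewrite gxE /=; apply/orP; left.
by rewrite in_imfset.
Qed.

Lemma card_moved_out_cons {G : groupType} (g : G) (s : seq G) (E : {fset G}) :
  (#|` moved_out (g :: s) E| <=
     #|` symdiff (ltrans g E) E| + #|` moved_out s E|)%N.
Proof.
apply: leq_trans (leq_add (card_moved_out1 g E) (leqnn _)).
apply: leq_trans (leq_card_fsetU _ _).
apply: fsubset_leq_card; apply/fsubsetP => x.
by rewrite !inE /= orbF => /andP[-> /orP[->|->]]; rewrite ?orbT.
Qed.

Lemma folner_moved_cvg0 {R : realType} {G : groupType} (F : nat -> {fset G})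
    (s : seq G) :
  folner R F ->
  (#|` moved_out s (F n)|%:R / #|` F n|%:R : R) @[n --> \oo] --> (0 : R).
Proof.
move=> [F0 Finv]; elim: s => [|g s IHs].
  rewrite (_ : (fun n => _) = cst 0); first exact: cvg_cst.
  apply/funext => n /=; rewrite (_ : moved_out _ _ = fset0) ?cardfs0 ?mul0r //.
  by apply/fsetP => x; rewrite !inE /= andbF.
have lim0 : #|` symdiff (ltrans g (F n)) (F n)|%:R / #|` F n|%:R
    + #|` moved_out s (F n)|%:R / #|` F n|%:R @[n --> \oo] --> (0 : R).
  by rewrite -[X in _ --> X]addr0; exact: cvgD (Finv g) IHs.
apply: squeeze_cvgr (cvg_cst 0) lim0.
apply: nearW => n; apply/andP; split; first by rewrite divr_ge0.
rewrite /= -mulrDl ler_wpM2r ?invr_ge0 // -natrD ler_nat.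
exact: card_moved_out_cons.
Qed.

Lemma subadditive_linear_bound {R : realType} {G : groupType}
    (f : {fset G} -> R)
    (f_inv : forall (E : {fset G}) (g : G),
       nonempty_fsets E -> f (rtrans E g) = f E)
    (f_sub : forall E F : {fset G},
       nonempty_fsets E -> nonempty_fsets F -> [disjoint E & F]%fset ->
       f (E `|` F)%fset <= f E + f F)
    (E : {fset G}) :
  nonempty_fsets E -> f E <= f [fset 1%g]%fset * #|` E|%:R.
Proof.
have [n] := ubnP #|` E|; elim: n E => // n IHn E ltEn E0.
have [x xE] := fset0Pn _ E0.
have f1 : f [fset x]%fset = f [fset 1%g]%fset.
  rewrite -(f_inv [fset 1%g]%fset x); last first.
    by rewrite /nonempty_fsets /= -cardfs_gt0 cardfs1.
  congr f; apply/fsetP => y; rewrite !inE; apply/eqP/imfsetP => /=.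
    by move=> ->; exists 1%g; rewrite ?inE ?mul1g.
  by move=> [z]; rewrite inE => /eqP -> ->; rewrite mul1g.
have x0 : nonempty_fsets [fset x]%fset.
  by rewrite /nonempty_fsets /= -cardfs_gt0 cardfs1.
move: ltEn; rewrite -(fsetD1K xE) (cardfsD1 x) !inE eqxx /= => ltEn.
have -> : ((x |` (E `\ x)) `\ x = E `\ x)%fset by rewrite fsetD1K.
rewrite natrD mulrDr mulr1.
have [->|D0] := eqVneq (E `\ x)%fset fset0.
  by rewrite fsetU0 cardfs0 mulr0 addr0 f1.
apply: le_trans (f_sub _ _ x0 D0 _) _.
  by rewrite fdisjoint1X !inE eqxx.
rewrite f1 lerD2l; apply: IHn => //.
by move: ltEn; rewrite (fsetD1K xE) add1n ltnS.
Qed.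

(** By induction on [E]: as long as some block lies in [E], remove it; this
    creates no escaping point, since blocks are pairwise disjoint, and when no
    block is left all points are escaping. *)
Lemma subadditive_packing {R : realType} {G : groupType} (f : {fset G} -> R)
    (tile : G -> {fset G}) (a b : R)
    (f_sub : forall E F : {fset G},
       nonempty_fsets E -> nonempty_fsets F -> [disjoint E & F]%fset ->
       f (E `|` F)%fset <= f E + f F)
    (f_lin : forall E : {fset G}, nonempty_fsets E -> f E <= b * #|` E|%:R)
    (tile_id : forall x, x \in tile x)
    (tile_eq : forall x y, y \in tile x -> tile y = tile x)
    (f_tile : forall x, f (tile x) = a * #|` tile x|%:R)
    (E : {fset G}) :
  nonempty_fsets E ->
  f E <= a * #|` E|%:R + (b - a) * #|` escaping tile E|%:R.
Proof.
have tile0 x : nonempty_fsets (tile x) by apply/fset0Pn; exists x.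
have leab : a <= b.
  (* [f] of a block is both [a] times and at most [b] times its cardinality. *)
  have := f_lin _ (tile0 1%g).
  by rewrite f_tile ler_pM2r // ltr0n cardfs_gt0; exact: tile0.
have [n] := ubnP #|` E|; elim: n E => // n IHn E ltEn E0.
have [[x xE]|noblock] := pselect (exists x, (tile x `<=` E)%fset); last first.
  rewrite (_ : escaping tile E = E); first by rewrite -mulrDl subrKC f_lin.
  apply/fsetP => x; rewrite !inE; case: (x \in E) => //=.
  by apply/negP => xE; apply: noblock; exists x.
set D := (E `\` tile x)%fset.
have cardE : #|` E| = (#|` tile x| + #|` D|)%N.
  by rewrite -(cardfsID (tile x) E) (fsetIidPr xE).
have [D0|D0] := eqVneq D fset0.
  have -> : E = tile x.
    by apply/eqP; rewrite eqEfsubset xE andbT -fsetD_eq0 -/D D0.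
  by rewrite f_tile lerDl mulr_ge0 ?subr_ge0.
have defE : (tile x `|` D)%fset = E.
  apply/fsetP => y; rewrite !inE.
  by case: (boolP (y \in tile x)) => //= /(fsubsetP xE) ->.
have disj : [disjoint tile x & D]%fset.
  by apply/fdisjointP => y yx; rewrite !inE yx.
have := f_sub _ _ (tile0 x) D0 disj; rewrite defE => /le_trans; apply.
have {}IHn : f D <= a * #|` D|%:R + (b - a) * #|` escaping tile D|%:R.
  apply: IHn => //; rewrite ltnS in ltEn; apply: leq_trans ltEn.
  by rewrite cardE -[X in (X < _)%N]add0n ltn_add2r cardfs_gt0; exact: tile0.
have escD : (escaping tile D `<=` escaping tile E)%fset.
  apply/fsubsetP => y; rewrite !inE => /andP[/andP[ynx yE]].
  rewrite yE /=; apply: contra => yE'.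
  apply/fsubsetP => z zy; rewrite !inE (fsubsetP yE' _ zy) andbT.
  apply: contra ynx => zx.
  by rewrite -(tile_eq _ _ zx) (tile_eq _ _ zy) tile_id.
rewrite f_tile cardE natrD mulrDr -addrA lerD2l.
apply: le_trans IHn _; rewrite lerD2l ler_wpM2l ?subr_ge0 // ler_nat.
exact: fsubset_leq_card.
Qed.

Lemma card_rtrans {G : groupType} (T : {fset G}) (c : G) :
  #|` rtrans T c| = #|` T|.
Proof. by rewrite /rtrans (card_imfset _ _ (mulIg c)). Qed.

(** A tile [T] of [G] yields a block function: [rtrans T (c x)] is the translate
    of [T] that contains [x].  Several centers may give the same translate, so
    [c x] is a choice and only the blocks, not the centers, are determined. *)
Lemma tile_block {G : groupType} (T : {fset G}) :
  tile_fsets T ->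
  exists c : G -> G,
    (forall x, x \in rtrans T (c x)) /\
    (forall x y, y \in rtrans T (c x) -> rtrans T (c y) = rtrans T (c x)).
Proof.
move=> [_ [_ [C [_ [cover_T triv_T _]]]]].
have ex x : exists c, C c /\ x \in rtrans T c.
  have : [set: G] x by [].
  rewrite -cover_T => -[_ [c Cc <-] [t tT txc]].
  by exists c; split=> //; apply/imfsetP; exists t.
have [c cP] := choice ex; exists c; split=> [x|x y yx]; first exact: (cP x).2.
have rtransE d : [set` rtrans T d] = [set (t * d)%g | t in [set` T]].
  apply/seteqP; split=> z /=.
    by move=> /imfsetP[t /= tT ->]; exists t.
  by move=> [t tT <-]; apply/imfsetP; exists t.
have eqB : [set` rtrans T (c y)] = [set` rtrans T (c x)].
  rewrite !rtransE; apply: triv_T.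
  - by exists (c y) => //; exact: (cP y).1.
  - by exists (c x) => //; exact: (cP x).1.
  - by exists y; rewrite -!rtransE; split=> //=; exact: (cP y).2.
by apply/fsetP => z; have /seteqP[sub_yx sub_xy] := eqB; apply/idP/idP => [/sub_yx|/sub_xy].
Qed.

(** That is, [limsup avg f (F n) <= avg f T]; the sets [F n] need not tile. *)
Lemma folner_avg_lt {R : realType} {G : groupType} (f : {fset G} -> R)
    (f_inv : forall (E : {fset G}) (g : G),
       nonempty_fsets E -> f (rtrans E g) = f E)
    (f_sub : forall E F : {fset G},
       nonempty_fsets E -> nonempty_fsets F -> [disjoint E & F]%fset ->
       f (E `|` F)%fset <= f E + f F)
    (F : nat -> {fset G}) (T : {fset G}) (r : R) :
  folner R F -> tile_fsets T -> avg f T < r ->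
  \forall n \near \oo, avg f (F n) < r.
Proof.
move=> FF tT ltTr; have [c [c_id c_eq]] := tile_block _ tT.
pose tile x := rtrans T (c x).
pose b := f [fset 1%g]%fset; pose a := avg f T.
pose s : seq G := [seq (t * u^-1)%g | t <- T, u <- T].
have T0 : nonempty_fsets T by case: tT.
have cardT0 : #|` T|%:R != 0 :> R by rewrite pnatr_eq0 cardfs_eq0.
have f_tile x : f (tile x) = a * #|` tile x|%:R.
  by rewrite f_inv // card_rtrans /a /avg divfK.
have f_lin := subadditive_linear_bound f f_inv f_sub.
have pack := subadditive_packing f tile a b f_sub f_lin c_id c_eq f_tile.
have leab : a <= b.
  by rewrite ler_pdivrMr ?f_lin // lt_neqAle eq_sym cardT0 ler0n.
have esc n : (escaping tile (F n) `<=` moved_out s (F n))%fset.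
  apply/fsubsetP => x; rewrite !inE => /andP[xF /fsubsetPn[y yx yF]].
  rewrite xF /=; apply/hasP.
  (* With [c] the center of the block of [x]: [x = u c] and [y = t c]
     give [y = (t u^-1) x]. *)
  have /imfsetP[u /= uT xE] := c_id x.
  move: yx => /imfsetP[t /= tT' yE].
  exists (t * u^-1)%g; first by apply/allpairsP; exists (t, u).
  by rewrite [X in (_ * X)%g]xE -mulgA mulKg -yE.
have lim0 := folner_moved_cvg0 F s FF.
have lim : a + (b - a) * (#|` moved_out s (F n)|%:R / #|` F n|%:R)
    @[n --> \oo] --> a.
  rewrite -[X in _ --> X](_ : a + (b - a) * 0 = a); last by rewrite mulr0 addr0.
  by apply: cvgD; [exact: cvg_cst|apply: cvgM lim0; exact: cvg_cst].
have : \forall n \near \oo,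
    a + (b - a) * (#|` moved_out s (F n)|%:R / #|` F n|%:R) < r.
  exact: (cvgr_lt _ lim).
apply: filterS => n; apply: le_lt_trans.
have F0 : 0 < #|` F n|%:R :> R by rewrite ltr0n cardfs_gt0; exact: FF.1.
rewrite /avg ler_pdivrMr // mulrDl mulrA divfK ?gt_eqF //.
apply: le_trans (pack _ (FF.1 n)) _.
by rewrite lerD2l ler_wpM2l ?subr_ge0 // ler_nat fsubset_leq_card.
Qed.

(** Convergence to a lower bound, [-oo] allowed, that is also an upper bound of
    the limsup. *)
Lemma cvge_inf {R : realType} (u : nat -> R) (l : \bar R) :
  (forall n, l <= (u n)%:E)%E ->
  (forall r : R, (l < r%:E)%E -> \forall n \near \oo, u n < r) ->
  (u n)%:E @[n --> \oo] --> l.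
Proof.
case: l => [l| |] lb ub.
- apply: cvg_EFin; first exact: nearW.
  apply/cvgrPdist_lt => e e0.
  have : \forall n \near \oo, u n < l + e by apply: ub; rewrite lte_fin ltrDl.
  apply: filterS => n ltn /=.
  have := lb n; rewrite lee_fin => len.
  by rewrite distrC ger0_norm ?subr_ge0 // ltrBlDl.
- by have := lb 0%N; rewrite leye_eq.
- apply/cvgeNyPlt => A; have := ub A (ltNyr A).
  by apply: filterS => n; rewrite lte_fin.
Qed.

Theorem proposition2p5 (R : realType) (G : groupType)
  (G_infinite : infinite_set [set: G])
  (G_countable : countable [set: G])
  (G_amenable : amenable R G)
  (G_tiling : exists F : nat -> {fset G}, tiling_folner R F)
  (f : {fset G} -> R)
  (f_invariant : forall (E : {fset G}) (g : G),
     nonempty_fsets E -> f (rtrans E g) = f E)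
  (f_subadditive : forall E F : {fset G},
     nonempty_fsets E -> nonempty_fsets F -> [disjoint E & F]%fset ->
     f (E `|` F)%fset <= f E + f F) :
  exists l : \bar R,
    [/\ (l < +oo)%E,
        forall F : nat -> {fset G}, tiling_folner R F ->
          (avg f (F n))%:E @[n --> \oo] --> l,
        l = ereal_inf [set (avg f E)%:E | E in tile_fsets (G := G)] &
        forall F : nat -> {fset G}, tiling_folner R F ->
          l = ereal_inf [set (avg f (F n))%:E | n in [set: nat]]].
Proof.
set l := ereal_inf [set (avg f E)%:E | E in tile_fsets (G := G)].
have le_l E : tile_fsets E -> (l <= (avg f E)%:E)%E.
  by move=> tE; apply: ereal_inf_lbound; exists E.
have near_l F (r : R) : tiling_folner R F -> (l < r%:E)%E ->
    \forall n \near \oo, avg f (F n) < r.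
  move=> [FF _] /ereal_inf_ltP[_ [T tT <-]]; rewrite lte_fin.
  exact: folner_avg_lt f_invariant f_subadditive _ _ _ FF tT.
have cvg_l F : tiling_folner R F -> (avg f (F n))%:E @[n --> \oo] --> l.
  by move=> tF; apply: cvge_inf => [n|r]; [exact/le_l/tF.2|exact: near_l].
exists l; split=> //.
- have [F [_ tF]] := G_tiling.
  exact: le_lt_trans (le_l _ (tF 0%N)) (ltry _).
- move=> F tF; apply/eqP; rewrite eq_le; apply/andP; split.
    by apply: le_ereal_inf_tmp => _ [n _ <-]; exact/le_l/tF.2.
  have lim_l := cvg_l F tF.
  rewrite -(cvg_lim _ lim_l) //; apply: lime_ge; first by apply/cvg_ex; exists l.
  by apply: nearW => n; apply: ereal_inf_lbound; exists n.
Qed.
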